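(* Let $q$ be a prime power and let $a,t,K$ be positive integers with $at>2$. Let $\mathbf{C}\in\mathbb{F}_q^{t\times K}$ with $\mathrm{rank}(\mathbf{C})=t$, put $m=at$, $n=aK$, and let $\mathbf{A}^S=\mathbf{I}_a\otimes\mathbf{C}\in\mathbb{F}_q^{m\times n}$ be the block-diagonal matrix with $a$ copies of $\mathbf{C}$ on the diagonal. If $l$ is an integer with $l\ge 2t$ and $q\ge a^{\frac{1}{l-t}}$, then there exists a matrix $\mathbf{S}\in\mathbb{F}_q^{l\times m}$ such that $\mathbf{H}=\mathbf{S}\mathbf{A}^S\in\mathbb{F}_q^{l\times n}$ is a valid encoder matrix (of codelength $l$) for the $(\mathbf{A}^S,1)$ function update problem over $\mathbb{F}_q$.
   Context: Vectors are column vectors and $\mathrm{wt}$ denotes Hamming weight. For $\mathbf{A}\in\mathbb{F}_q^{m\times n}$ of rank $m$ and a positive integer $\epsilon$, in the $(\mathbf{A},\epsilon)$ function update problem over $\mathbb{F}_q$ a matrix $\mathbf{H}\in\mathbb{F}_q^{l\times n}$ is called a valid encoder matrix of codelength $l$ if there exists a function $\mathfrak{D}:\mathbb{F}_q^l\times\mathbb{F}_q^m\to\mathbb{F}_q^m$ such that $\mathfrak{D}(\mathbf{H}(\mathbf{x}+\mathbf{e}),\mathbf{A}\mathbf{x})=\mathbf{A}(\mathbf{x}+\mathbf{e})$ for all $\mathbf{x},\mathbf{e}\in\mathbb{F}_q^n$ with $\mathrm{wt}(\mathbf{e})\le\epsilon$. *)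

(* Defs.v *)
From HB Require Import structures.
From mathcomp Require Import all_boot all_order all_algebra all_field.
From mathcomp Require Import mxtens.

Set Implicit Arguments.
Unset Strict Implicit.
Unset Printing Implicit Defensive.

Import GRing.Theory.
Local Open Scope ring_scope.

Definition wt (F : finFieldType) (n : nat) (x : 'cV[F]_n) : nat :=
  #|[set i | x i 0 != 0]|.

(* H is a valid encoder matrix of codelength l for the (A, eps) function update
   problem.  That problem is posed for A of full row rank m and eps > 0; these
   conditions on the instance are not repeated here. *)
Definition valid_encoder (F : finFieldType) (m n l : nat) (A : 'M[F]_(m, n))
    (eps : nat) (H : 'M[F]_(l, n)) : Prop :=
  exists D : 'cV[F]_l -> 'cV[F]_m -> 'cV[F]_m,
    forall x e : 'cV[F]_n, (wt e <= eps)%N ->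
      D (H *m (x + e)) (A *m x) = A *m (x + e).

(* The Kronecker product *t of mxtens has entry A i j * B k h at row
   i * (height of B) + k and column j * (width of B) + h, so this matrix is
   block diagonal with a copies of C. *)
Definition AS (F : finFieldType) (a t K : nat) (C : 'M[F]_(t, K)) :
    'M[F]_(a * t, a * K) :=
  (1%:M : 'M[F]_a) *t C.

(* Main.v *)
Require Import Defs.
From HB Require Import structures.
From mathcomp Require Import all_boot all_order all_algebra all_field.
From mathcomp Require Import mxtens.

(* A decoder exists as soon as S separates the vectors A^S e with wt e <= 1,
   and each of these is supported in a single block of length t. Take the i-th
   block of columns of S to be [I_t; M_i], where the a <= q^(l-t) matrices M_i
   have pairwise differences of full column rank t. If S sends u in block i and
   v in block j to the same vector, then u = v by the upper part, and
   (M_i - M_j) u = 0 forces i = j or u = 0. *)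

Set Implicit Arguments.
Unset Strict Implicit.
Unset Printing Implicit Defensive.

Import GRing.Theory Num.Theory.
Local Open Scope ring_scope.

(** [#|F|] is a power of the characteristic, so it vanishes in [L] and the derivative is the
    constant -1. *)
Lemma separable_Xcard_subX (F : finFieldType) (L : fieldExtType F) d :
  (0 < d)%N -> separable_poly ('X^(#|F| ^ d) - 'X : {poly L}).
Proof.
move=> d_gt0; have [p _ pcharFp] := finPcharP F.
have q0 : #|F|%:R = 0 :> L.
  have [n n_gt0 ->] : exists2 n, (0 < n)%N & #|F| = (p ^ n)%N.
    exists (logn p #|F|); last exact: card_pprimeChar.
    rewrite lt0n; apply/eqP=> n0.
    by have := finNzRing_gt1 F; rewrite (card_pprimeChar pcharFp) n0.
  by rewrite natrX pcharf0 ?pchar_lalg // expr0n gtn_eqF.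
rewrite separable_poly.unlock derivB derivXn derivX -scaler_nat natrX q0.
rewrite expr0n gtn_eqF // scale0r sub0r.
rewrite -[X in coprimep _ X]scaleN1r coprimepZr ?coprimep1 //.
by rewrite oppr_eq0 oner_eq0.
Qed.

(** [L] is the splitting field of X^(q^d) - X with q = [#|F|]. The q^d distinct roots form a
    subfield, hence all of [L], and counting them gives the dimension. *)
Lemma finField_ext_exists (F : finFieldType) d :
  (0 < d)%N -> exists L : fieldExtType F, \dim {:L} = d.
Proof.
move=> d_gt0; set m := (#|F| ^ d)%N.
have m_gt1 : (1 < m)%N by rewrite -(exp1n d) ltn_exp2r ?finNzRing_gt1.
pose q (R : nzRingType) : {poly R} := 'X^m - 'X.
have size_q R : size (q R) = m.+1.
  by rewrite size_polyDl size_polyXn // size_polyN size_polyX.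
have /FinSplittingFieldFor[/= L] : q F != 0 by rewrite -size_poly_eq0 size_q.
rewrite [map_poly _ _]rmorphB rmorphXn /= map_polyX -/(q L) => -[zs Dq defL].
have Uzs : uniq zs.
  by rewrite -separable_prod_XsubC -(eqp_separable Dq) separable_Xcard_subX.
have [alpha _ Dalpha] := finField_galois_generator (sub1v {:L}%AS).
pose E := fixedSpace (alpha ^+ d)%g.
(* [alpha] is the Frobenius map z -> z^q, so its d-th power fixes exactly the roots. *)
have in_zs : zs =i E.
  move=> z; rewrite -root_prod_XsubC -(eqp_root Dq) (sameP fixedSpaceP eqP).
  rewrite /root !hornerE subr_eq0; congr (_ == z).
  rewrite /m; elim: (d) => [|i IHi]; first by rewrite gal_id.
  by rewrite expgSr expnSr exprM IHi galM ?memvf // Dalpha ?memvf // dimv1 expn1.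
have fullE : E = {:L}%VS.
  apply/eqP; rewrite eqEsubv subvf -defL -[E]subfield_closed agenvS //.
  by rewrite subv_add sub1v; apply/span_subvP=> z; rewrite in_zs.
exists L; apply: (expnI (finNzRing_gt1 F)).
rewrite -(card_vspace ({:finvect_type L})%VS).
have -> : #|{: finvect_type L}%VS| = size zs.
  have := card_uniqP (T := finvect_type L) Uzs => <-.
  by apply: eq_card => z; rewrite [RHS]in_zs fullE.
by apply: succn_inj; rewrite -(size_prod_XsubC _ id) -(eqp_size Dq) size_q.
Qed.

(* A Gabidulin code: F^t is embedded in the extension L of F of degree d, and
   the matrices represent multiplication by the elements of L. *)
Lemma rank_distance_code (F : finFieldType) (a t d : nat) :
    (0 < d)%N -> (t <= d)%N -> (a <= #|F| ^ d)%N ->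
  exists M : 'I_a -> 'M[F]_(d, t),
    forall i j (v : 'cV_t), M i *m v = M j *m v -> i = j \/ v = 0.
Proof.
move=> d_gt0 le_td le_a; have [L dimL] := finField_ext_exists F d_gt0.
subst d; pose b := vbasis {:L}.
have cardL : #|finvect_type L| = (#|F| ^ \dim {:L})%N.
  rewrite -(card_vspace ({:finvect_type L})%VS).
  by apply: eq_card => x; rewrite [RHS]memvf.
have le_aL : (a <= #|finvect_type L|)%N by rewrite cardL.
pose z (i : 'I_a) : L := nth 0 (enum (finvect_type L)) i.
have z_inj : injective z.
  have ltz (i : 'I_a) : (i < size (enum (finvect_type L)))%N.
    by rewrite -cardE (leq_trans (ltn_ord i)).
  move=> i j /eqP zij; apply/val_inj/eqP.
  by rewrite -(nth_uniq 0 (ltz i) (ltz j)) ?enum_uniq.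
(* The first t basis vectors of [L] embed F^t; the i-th matrix sends v to the coordinates of
   [z i * x v]. *)
pose x (v : 'cV[F]_t) : L := \sum_s v s 0 *: b`_(widen_ord le_td s).
exists (fun i => \matrix_(r, s) coord b r (z i * b`_(widen_ord le_td s))).
have ME i v r : ((\matrix_(r, s) coord b r (z i * b`_(widen_ord le_td s)))
    *m v) r 0 = coord b r (z i * x v).
  rewrite mxE mulr_sumr linear_sum; apply: eq_bigr => s _.
  by rewrite mxE -scalerAr linearZ mulrC.
move=> i j v eqM; have : z i * x v = z j * x v.
  rewrite (coord_vbasis (memvf (z i * x v))) (coord_vbasis (memvf (z j * x v))).
  by apply: eq_bigr => r _; rewrite -!ME eqM.
move/eqP; rewrite -subr_eq0 -mulrBl mulf_eq0 subr_eq0.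
case/orP=> [/eqP/z_inj | /eqP xv0]; first by left.
right; apply/colP=> s; rewrite mxE.
have coord_b s' :
    coord b (widen_ord le_td s) (v s' 0 *: b`_(widen_ord le_td s')) =
    v s' 0 * (s' == s)%:R.
  rewrite linearZ; congr (_ * _).
  exact: coord_free (widen_ord _ _) (widen_ord _ _) (basis_free (vbasisP _)).
have := congr1 (coord b (widen_ord le_td s)) xv0.
rewrite linear0 linear_sum (eq_bigr _ (fun s' _ => coord_b s')) (bigD1 s) //=.
rewrite eqxx mulr1 big1 ?addr0 // => s' /negbTE ne_s.
by rewrite ne_s mulr0.
Qed.

(** By linearity the decoder recovers S A e from its two inputs, then picks any low-weight e' with
    the same image; by hypothesis A e' = A e. *)
Lemma valid_encoder_mulmx (F : finFieldType) (m n l eps : nat)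
    (A : 'M[F]_(m, n)) (S : 'M[F]_(l, m)) :
    (forall e e' : 'cV_n, (wt e <= eps)%N -> (wt e' <= eps)%N ->
       S *m (A *m e) = S *m (A *m e') -> A *m e = A *m e') ->
  valid_encoder A eps (S *m A).
Proof.
move=> inj_S.
exists (fun y z => z + A *m odflt 0 [pick e : 'cV[F]_n |
  (wt e <= eps)%N && (S *m (A *m e) == y - S *m z)]) => x e wt_e.
rewrite !mulmxDr -!mulmxA [S *m _ + _]addrC addrK.
case: pickP => [e' /andP[wt_e' /eqP Se'] | /(_ e)] /=; last first.
  by rewrite wt_e eqxx.
by rewrite (inj_S e' e).
Qed.

Lemma mxtens_index_bij m n : bijective (@mxtens_index m n).
Proof.
exact: (Bijective (@mxtens_indexK m n) (@mxtens_unindexK m n)).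
Qed.

Definition blockv (R : nzRingType) (a t : nat) (j : 'I_a) (u : 'cV[R]_t) :
    'cV[R]_(a * t) :=
  \col_k (((mxtens_unindex k).1 == j)%:R * u (mxtens_unindex k).2 0).

Lemma AS_mul_wt1 (F : finFieldType) (a t K : nat) (C : 'M[F]_(t, K))
    (e : 'cV[F]_(a * K)) :
    (0 < a)%N -> (wt e <= 1)%N ->
  exists j u, AS a C *m e = blockv j u.
Proof.
move=> a_gt0 wt_e.
have [k0 Dk] : exists j : 'I_a, forall k, (mxtens_unindex k).1 != j -> e k 0 = 0.
  have [/eqP/cards1P[k0 Dk0] | ] := eqVneq (wt e) 1%N.
    exists (mxtens_unindex k0).1 => k ne_k; apply/eqP; apply: contraR ne_k => ek.
    have : k \in [set i | e i 0 != 0] by rewrite inE.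
    by rewrite Dk0 inE => /eqP->.
  rewrite neq_ltn [(1 < _)%N]ltnNge wt_e orbF ltnS leqn0 => /eqP/cards0_eq e0.
  (* Here e = 0, so any block will do. *)
  exists (Ordinal a_gt0) => k _; apply/eqP; apply: contraFT (in_set0 k).
  by rewrite -e0 inE.
(* The vector u is [C] applied to the segment of e in block [k0]. *)
exists k0, (C *m \col_h e (mxtens_index (k0, h)) 0).
apply/colP=> r; case: (mxtens_indexP r) => i s.
rewrite !mxE mxtens_indexK /=.
rewrite (reindex _ (onW_bij _ (mxtens_index_bij a K))) /=.
rewrite (eq_bigr (fun p =>
  (1%:M : 'M_a) i p.1 * C s p.2 * e (mxtens_index (p.1, p.2)) 0)); last first.
  by case=> j h _; rewrite tensmxE.
rewrite -(pair_big predT predT (fun j h =>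
  (1%:M : 'M_a) i j * C s h * e (mxtens_index (j, h)) 0)) /=.
rewrite (bigD1 k0) //= [X in _ + X]big1 ?addr0 => [|j ne_j].
  rewrite mulr_sumr; apply: eq_bigr => h _.
  by rewrite !mxE -mulrA.
by apply: big1 => h _; rewrite Dk ?mulr0 // mxtens_indexK.
Qed.

Definition block_row (R : nzRingType) (a t l : nat) (N : 'I_a -> 'M[R]_(l, t)) :
    'M[R]_(l, a * t) :=
  \matrix_(r, k) N (mxtens_unindex k).1 r (mxtens_unindex k).2.

Lemma block_row_blockv (R : nzRingType) (a t l : nat)
    (N : 'I_a -> 'M[R]_(l, t)) j u :
  block_row N *m blockv j u = N j *m u.
Proof.
apply/colP=> r; rewrite !mxE.
rewrite (reindex _ (onW_bij _ (mxtens_index_bij a t))) /=.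
rewrite (eq_bigr (fun p => N p.1 r p.2 * ((p.1 == j)%:R * u p.2 0))); last first.
  by move=> p _; rewrite !mxE mxtens_indexK.
rewrite -(pair_big predT predT (fun i s => N i r s * ((i == j)%:R * u s 0))) /=.
rewrite (bigD1 j) //= [X in _ + X]big1 ?addr0 => [|i /negbTE ne_i].
  by apply: eq_bigr => s _; rewrite eqxx mul1r.
by apply: big1 => s _; rewrite ne_i mul0r mulr0.
Qed.

(** Turns the bound on q, stated with a root in [algC], into the bound a <= q^(l-t) that the code
    needs. *)
Lemma rootC_le_nat (n a b : nat) :
  (0 < n)%N -> n.-root (a%:R : algC) <= b%:R -> (a <= b ^ n)%N.
Proof.
move=> n_gt0 le_ab; rewrite -(ler_nat algC) natrX -[leLHS](rootCK n_gt0).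
by rewrite lerXn2r // nnegrE ?rootC_ge0 ?ler0n.
Qed.

Theorem mainTheorem6 (F : finFieldType) (a t K : nat)
    (a_gt0 : (0 < a)%N) (t_gt0 : (0 < t)%N) (K_gt0 : (0 < K)%N)
    (at_gt2 : (2 < a * t)%N)
    (C : 'M[F]_(t, K)) (rankC : \rank C = t)
    (l : nat) (l_ge2t : (2 * t <= l)%N)
    (q_ge : (l - t).-root (a%:R : algC) <= #|F|%:R) :
  exists S : 'M[F]_(l, a * t), valid_encoder (AS a C) 1 (S *m AS a C).
Proof.
have le_tl : (t <= l)%N by rewrite (leq_trans _ l_ge2t) ?leq_pmull.
(* This is where l >= 2t enters: F^t must embed in the extension of degree l - t. *)
have le_td : (t <= l - t)%N by rewrite leq_subRL // addnn -mul2n.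
have d_gt0 : (0 < l - t)%N := leq_trans t_gt0 le_td.
have [M M_dist] := rank_distance_code d_gt0 le_td (rootC_le_nat d_gt0 q_ge).
have -> : l = (t + (l - t))%N by rewrite subnKC.
exists (block_row (fun i => col_mx 1%:M (M i))); apply: valid_encoder_mulmx.
move=> e e' /(AS_mul_wt1 C a_gt0)[i [u ->]] /(AS_mul_wt1 C a_gt0)[j [v ->]].
rewrite !block_row_blockv !mul_col_mx !mul1mx => /eq_col_mx[<-{v}] /M_dist.
by case=> [-> // | ->]; apply/colP=> k; rewrite !mxE !mulr0.
Qed.
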